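(* The multiplicative structure of the ring $K_0(\mathrm{Coh}_0(\mathfrak{X}))$ depends only on the characteristic $p\geq 0$ of the ground field $k$. That is: if $k$ and $k'$ are fields of the same characteristic $p\geq 0$, $F\in k[[x,y]]$ and $F'\in k'[[x,y]]$ are one-dimensional formal group laws, and for all $m,n\geq 1$ one writes $f_mf_n=\sum_{i\ge 1}\lambda_i f_i$ for the product formed with $(k,F)$ and $f_mf_n=\sum_{i\geq 1}\lambda_i' f_i$ for the product formed with $(k',F')$, then $\lambda_i=\lambda_i'$ for all $i\geq 1$.
   Context: Let $k$ be a field of characteristic $p\geq 0$ and $\mathfrak{X}=\mathrm{Spf}(k[[t]])$ the formal affine line. $\mathrm{Coh}_0(\mathfrak{X})$ is the category of coherent $\mathcal{O}_{\mathfrak{X}}$-modules supported by the origin; it is equivalent to the category of pairs $(V,\varphi)$ where $V$ is a finite-dimensional $k$-vector space and $\varphi$ is a nilpotent endomorphism of $V$ (the action of $t$). $K_0(\mathrm{Coh}_0(\mathfrak{X}))$ denotes the free abelian group on isomorphism classes $[V]$ of objects modulo the relations $[V]=[V']+[V'']$ for direct sum decompositions $V\simeq V'\oplus V''$ (only split sequences are used). By Jordan normal form, it is a free abelian group with basis $f_n$, $n\geq 1$, where $f_n$ is the class of $k[[t]]/(t^n)$ with multiplication by $t$, equivalently of $k^n$ with the nilpotent Jordan block $J_n$ of size $n$. Given a (one-dimensional) formal group law $F(x,y)\in k[[x,y]]$, the ring structure on $K_0(\mathrm{Coh}_0(\mathfrak{X}))$ is induced by the convolution product, which sends $(V,\varphi)$,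 $(V',\varphi')$ to the vector space $V\otimes_k V'$ with the nilpotent endomorphism $F(\varphi\otimes\mathrm{id}_{V'},\mathrm{id}_V\otimes\varphi')$. *)

(* Defs.v *)
From HB Require Import structures.
From mathcomp Require Import all_boot all_order all_algebra.
From mathcomp Require Import boolp.
From mathcomp Require Import freeg mxtens.

Set Implicit Arguments.
Unset Strict Implicit.
Unset Printing Implicit Defensive.

Import GRing.Theory.
Local Open Scope ring_scope.
Local Open Scope quotient_scope.

Section FormalGroupLaws.
Variable k : fieldType.

(* Power series are given by their coefficients: [F i j] is the coefficient
   of x^i y^j and [G a b c] the coefficient of x^a y^b z^c. *)
Definition series2 := nat -> nat -> k.
Definition series3 := nat -> nat -> nat -> k.

Definition series3_one : series3 :=
  fun a b c => ((a == 0) && (b == 0) && (c == 0))%N%:R.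

Definition series3_mul (G H : series3) : series3 := fun a b c =>
  \sum_(i < a.+1) \sum_(j < b.+1) \sum_(l < c.+1)
    G i j l * H (a - i)%N (b - j)%N (c - l)%N.

Definition series3_exp (G : series3) (n : nat) : series3 :=
  iter n (series3_mul G) series3_one.

(* F(G, H) for series G and H without constant term: G^i H^j has order at
   least i + j, so only the i, j <= a + b + c contribute to x^a y^b z^c. *)
Definition series_subst (F : series2) (G H : series3) : series3 := fun a b c =>
  \sum_(i < (a + b + c).+1) \sum_(j < (a + b + c).+1)
    F i j * series3_mul (series3_exp G i) (series3_exp H j) a b c.

Definition series_x : series3 :=
  fun a b c => ((a == 1) && (b == 0) && (c == 0))%N%:R.
Definition series_z : series3 :=
  fun a b c => ((a == 0) && (b == 0) && (c == 1))%N%:R.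
Definition series_xy (F : series2) : series3 :=
  fun a b c => if c == 0%N then F a b else 0.
Definition series_yz (F : series2) : series3 :=
  fun a b c => if a == 0%N then F b c else 0.

(* F(x, 0) = x, F(0, y) = y and F(F(x, y), z) = F(x, F(y, z)).  Over a field
   these imply F(x, y) = F(y, x). *)
Record fgl := Fgl {
  fgl_coef :> series2;
  fgl_x0 : forall i, fgl_coef i 0%N = (i == 1)%N%:R;
  fgl_0y : forall j, fgl_coef 0%N j = (j == 1)%N%:R;
  fgl_assoc : forall a b c,
    series_subst fgl_coef (series_xy fgl_coef) series_z a b c =
    series_subst fgl_coef series_x (series_yz fgl_coef) a b c
}.

End FormalGroupLaws.

Section NilpotentEndomorphisms.
Variable k : fieldType.

Definition nilpotent n (A : 'M[k]_n) : Prop := exists N, A ^+ N = 0.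

(* Up to isomorphism every pair (V, phi) has V = k^d; matrices act on row
   vectors. *)
Record nilmod := Nilmod {
  nilmod_pair : {d : nat & 'M[k]_d};
  nilmod_nilp : `[< nilpotent (projT2 nilmod_pair) >]
}.

HB.instance Definition _ := [isSub for nilmod_pair].
HB.instance Definition _ := [Choice of nilmod by <:].

Definition nilmod_dim (V : nilmod) : nat := projT1 (nilmod_pair V).
Definition nilmod_mx (V : nilmod) : 'M[k]_(nilmod_dim V) :=
  projT2 (nilmod_pair V).
Definition mk_nilmod n (A : 'M[k]_n) (hA : nilpotent A) : nilmod :=
  @Nilmod (existT (fun d => 'M[k]_d) n A) (asboolT hA).

Lemma nilmod_mxP (V : nilmod) : nilpotent (nilmod_mx V).
Proof. exact: asboolW (nilmod_nilp V). Qed.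

Definition nilmod_iso (V W : nilmod) : Prop :=
  exists (P : 'M[k]_(nilmod_dim V, nilmod_dim W))
         (Q : 'M[k]_(nilmod_dim W, nilmod_dim V)),
    [/\ P *m Q = 1%:M, Q *m P = 1%:M & nilmod_mx V *m P = P *m nilmod_mx W].

Lemma block_diag_exp m n (A : 'M[k]_m) (B : 'M[k]_n) N :
  block_mx A 0 0 B ^+ N = block_mx (A ^+ N) 0 0 (B ^+ N).
Proof.
elim: N => [|N IH]; first by rewrite !expr0; exact: scalar_mx_block.
rewrite !exprS IH -!mulmxE mulmx_block.
by rewrite !mul0mx !mulmx0 !addr0 !add0r.
Qed.

Lemma nilpotent_le n (A : 'M[k]_n) N M :
  (N <= M)%N -> A ^+ N = 0 -> A ^+ M = 0.
Proof. by move=> le A0; rewrite -(subnK le) exprD A0 mulr0. Qed.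

Lemma nilpotent_block m n (A : 'M[k]_m) (B : 'M[k]_n) :
  nilpotent A -> nilpotent B -> nilpotent (block_mx A 0 0 B).
Proof.
move=> [N A0] [M B0]; exists (N + M)%N; rewrite block_diag_exp.
rewrite (nilpotent_le (leq_addr _ _) A0) (nilpotent_le (leq_addl _ _) B0).
exact: block_mx0.
Qed.

Definition nilmod_dsum (V W : nilmod) : nilmod :=
  mk_nilmod (nilpotent_block (nilmod_mxP V) (nilmod_mxP W)).

Definition jordan_mx n : 'M[k]_n := \matrix_(i, j) (j == i.+1 :> nat)%:R.

Lemma jordan_mx_expE n N (i j : 'I_n) :
  (j < i + N)%N -> (jordan_mx n ^+ N) i j = 0.
Proof.
elim: N i j => [|N IH] i j lt_j.
  rewrite expr0 mxE; case: eqP => // eq_ij.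
  by rewrite eq_ij addn0 ltnn in lt_j.
rewrite exprSr -mulmxE mxE big1 // => l _.
have [lt_l|le_l] := ltnP l (i + N); first by rewrite IH ?mul0r.
rewrite [jordan_mx n l j]mxE; case: eqP => [eq_j|]; last by rewrite mulr0.
by move: lt_j; rewrite eq_j addnS ltnS ltnNge le_l.
Qed.

Lemma nilpotent_jordan n : nilpotent (jordan_mx n).
Proof.
exists n; apply/matrixP => i j; rewrite jordan_mx_expE ?mxE //.
by rewrite (leq_trans (ltn_ord j)) ?leq_addl.
Qed.

Definition jordan_block n : nilmod := mk_nilmod (@nilpotent_jordan n).

Lemma nilpotent_dim n (A : 'M[k]_n) : nilpotent A -> A ^+ n = 0.
Proof.
case: n A => [|n] A [N A0]; first by apply/matrixP => [[]].
have: mxminpoly A %| ('X - 0%:P) ^+ N.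
  by apply: mxminpoly_min; rewrite subr0 rmorphXn /= horner_mx_X.
case/dvdp_exp_XsubCP => s _ eqp.
have le_s : (s <= n.+1)%N.
  have := dvdp_leq (monic_neq0 (char_poly_monic A)) (mxminpoly_dvd_char A).
  by rewrite (eqp_size eqp) size_exp_XsubC size_char_poly ltnS.
apply: (nilpotent_le le_s).
have : mxminpoly A %| ('X - 0%:P) ^+ s by rewrite (eqp_dvdl _ eqp).
by move/mxminpoly_minP; rewrite subr0 rmorphXn /= horner_mx_X.
Qed.

Section Evaluation.
Variable F : series2 k.

(* F(A, B) for commuting nilpotent endomorphisms A, B of k^d; the powers
   from d on vanish. *)
Definition eval_mx d (A B : 'M[k]_d) : 'M[k]_d :=
  \sum_(i < d) \sum_(j < d) F i j *: (A ^+ i *m B ^+ j).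

Definition trunc_eval N d (A B : 'M[k]_d) : 'M[k]_d :=
  \sum_(i < N) \sum_(j < N) F i j *: (A ^+ i *m B ^+ j).

Lemma trunc_evalE N a d (A B : 'M[k]_d) :
  A ^+ a = 0 -> B ^+ a = 0 -> (a <= N)%N ->
  trunc_eval N A B = trunc_eval a A B.
Proof.
move=> A0 B0 le_aN; rewrite /trunc_eval.
rewrite (big_ord_widen_cond N predT
  (fun i => \sum_(j < a) F i j *: (A ^+ i *m B ^+ j)) le_aN).
rewrite [in RHS]big_mkcond /=; apply: eq_bigr => i _.
case: ltnP => lt_i; last first.
  by rewrite big1 // => j _; rewrite (nilpotent_le lt_i A0) mul0mx scaler0.
rewrite (big_ord_widen_cond N predT
  (fun j => F i j *: (A ^+ i *m B ^+ j)) le_aN).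
rewrite [in RHS]big_mkcond /=; apply: eq_bigr => j _.
by case: ltnP => // lt_j; rewrite (nilpotent_le lt_j B0) mulmx0 scaler0.
Qed.

Lemma eval_mxE N d (A B : 'M[k]_d) : nilpotent A -> nilpotent B ->
  (d <= N)%N -> eval_mx A B = trunc_eval N A B.
Proof.
move=> A0 B0 le_dN.
by rewrite (trunc_evalE (nilpotent_dim A0) (nilpotent_dim B0)).
Qed.

Lemma exp_intertwine d e (A : 'M[k]_d) (A' : 'M[k]_e) (P : 'M[k]_(d, e)) i :
  A *m P = P *m A' -> A ^+ i *m P = P *m A' ^+ i.
Proof.
move=> AP; elim: i => [|i IH].
  by rewrite !expr0 -!idmxE mul1mx mulmx1.
by rewrite !exprSr -!mulmxE -mulmxA AP mulmxA IH mulmxA.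
Qed.

Lemma eval_mx_intertwine d e (A B : 'M[k]_d) (A' B' : 'M[k]_e)
    (P : 'M[k]_(d, e)) :
  nilpotent A -> nilpotent B -> nilpotent A' -> nilpotent B' ->
  A *m P = P *m A' -> B *m P = P *m B' ->
  eval_mx A B *m P = P *m eval_mx A' B'.
Proof.
move=> hA hB hA' hB' AP BP.
rewrite (eval_mxE hA hB (leq_addr e d)) (eval_mxE hA' hB' (leq_addl d e)).
rewrite /trunc_eval mulmx_suml mulmx_sumr; apply: eq_bigr => i _.
rewrite mulmx_suml mulmx_sumr; apply: eq_bigr => j _.
rewrite -scalemxAl -scalemxAr -mulmxA (exp_intertwine _ BP).
by rewrite mulmxA (exp_intertwine _ AP) mulmxA.
Qed.

Lemma nilpotent_eval d (A B : 'M[k]_d) : F 0%N 0%N = 0 ->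
  A *m B = B *m A -> nilpotent A -> nilpotent B -> nilpotent (eval_mx A B).
Proof.
move=> F00 AB /nilpotent_dim A0 /nilpotent_dim B0.
suff main r i j : (d + d <= i + j + r)%N ->
    A ^+ i *m B ^+ j *m eval_mx A B ^+ r = 0.
  exists (d + d)%N; have := @main (d + d)%N 0%N 0%N (leqnn _).
  by rewrite !expr0 -!idmxE !mul1mx; exact.
elim: r i j => [|r IH] i j le_d.
  rewrite addn0 in le_d; have [le_i|lt_i] := leqP d i.
    by rewrite (nilpotent_le le_i A0) !mul0mx.
  have le_j : (d <= j)%N.
    rewrite -(leq_add2l d); apply: leq_trans le_d _.
    by rewrite leq_add2r ltnW.
  by rewrite (nilpotent_le le_j B0) mulmx0 mul0mx.
rewrite exprS -mulmxE mulmxA /eval_mx mulmx_sumr mulmx_suml big1 // => s _.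
rewrite mulmx_sumr mulmx_suml big1 // => t _.
have [st0|st_gt0] := posnP (s + t).
  move/eqP: st0; rewrite addn_eq0 => /andP[/eqP-> /eqP->].
  by rewrite F00 scale0r mulmx0 mul0mx.
rewrite -scalemxAr -scalemxAl.
have -> : A ^+ i *m B ^+ j *m (A ^+ s *m B ^+ t) =
          A ^+ (i + s) *m B ^+ (j + t).
  rewrite !exprD -!mulmxE -!mulmxA; congr (_ *m _); rewrite !mulmxA.
  congr (_ *m _).
  by rewrite !mulmxE; apply: commrX; apply/commr_sym/commrX; rewrite /GRing.comm.
rewrite IH ?scaler0 //.
apply: leq_trans le_d _; rewrite (addnACA i s j t) -(addnA (i + j)) leq_add2l.
by rewrite -[r.+1]add1n leq_add2r.
Qed.

End Evaluation.

Section Convolution.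
Variable F : fgl k.

(* F(A (x) id, id (x) B) on k^m (x) k^n = k^(m * n). *)
Definition conv_mx m n (A : 'M[k]_m) (B : 'M[k]_n) : 'M[k]_(m * n) :=
  eval_mx F (A *t 1%:M) (1%:M *t B).

Lemma tensmx_expl m n (A : 'M[k]_m) i :
  (A *t (1%:M : 'M[k]_n)) ^+ i = A ^+ i *t 1%:M.
Proof.
elim: i => [|i IH].
  rewrite !expr0; apply/matrixP => x y.
  case: (mxtens_indexP x) => x1 x2; case: (mxtens_indexP y) => y1 y2.
  rewrite tensmxE !mxE (can_eq (@mxtens_indexK m n)) xpair_eqE.
  by rewrite -natrM mulnb.
by rewrite !exprS IH -!mulmxE tensmx_mul mulmx1.
Qed.

Lemma tensmx11 m n : (1%:M : 'M[k]_m) *t (1%:M : 'M[k]_n) = 1%:M.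
Proof. by have := @tensmx_expl m n 1%:M 0; rewrite !expr0. Qed.

Lemma tensmx_expr m n (B : 'M[k]_n) i :
  ((1%:M : 'M[k]_m) *t B) ^+ i = 1%:M *t B ^+ i.
Proof.
elim: i => [|i IH].
  by rewrite !expr0; exact/esym/tensmx11.
by rewrite !exprS IH -!mulmxE tensmx_mul mulmx1.
Qed.

Lemma nilpotent_tensl m n (A : 'M[k]_m) :
  nilpotent A -> nilpotent (A *t (1%:M : 'M[k]_n)).
Proof. by move=> [N A0]; exists N; rewrite tensmx_expl A0 tens0mx. Qed.

Lemma nilpotent_tensr m n (B : 'M[k]_n) :
  nilpotent B -> nilpotent ((1%:M : 'M[k]_m) *t B).
Proof. by move=> [N B0]; exists N; rewrite tensmx_expr B0 tensmx0. Qed.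

Lemma nilpotent_conv m n (A : 'M[k]_m) (B : 'M[k]_n) :
  nilpotent A -> nilpotent B -> nilpotent (conv_mx A B).
Proof.
move=> hA hB; apply: nilpotent_eval.
- by rewrite fgl_x0.
- by rewrite !tensmx_mul !mul1mx !mulmx1.
- exact: nilpotent_tensl.
- exact: nilpotent_tensr.
Qed.

Definition nilmod_conv (V W : nilmod) : nilmod :=
  mk_nilmod (nilpotent_conv (nilmod_mxP V) (nilmod_mxP W)).

Lemma conv_mx_intertwine m m' n n' (A : 'M[k]_m) (A' : 'M[k]_m')
    (B : 'M[k]_n) (B' : 'M[k]_n') (P : 'M[k]_(m, m')) (Q : 'M[k]_(n, n')) :
  nilpotent A -> nilpotent A' -> nilpotent B -> nilpotent B' ->
  A *m P = P *m A' -> B *m Q = Q *m B' ->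
  conv_mx A B *m (P *t Q) = (P *t Q) *m conv_mx A' B'.
Proof.
move=> hA hA' hB hB' AP BQ; apply: eval_mx_intertwine;
  try by [apply: nilpotent_tensl | apply: nilpotent_tensr].
- by rewrite !tensmx_mul AP mul1mx mulmx1.
- by rewrite !tensmx_mul BQ mul1mx mulmx1.
Qed.

Lemma nilmod_conv_iso V V' W W' : nilmod_iso V V' -> nilmod_iso W W' ->
  nilmod_iso (nilmod_conv V W) (nilmod_conv V' W').
Proof.
move=> [P [P' [PP' P'P VP]]] [Q [Q' [QQ' Q'Q WQ]]].
exists (P *t Q), (P' *t Q'); split.
- by rewrite tensmx_mul PP' QQ' tensmx11.
- by rewrite tensmx_mul P'P Q'Q tensmx11.
- by apply: conv_mx_intertwine => //; apply: nilmod_mxP.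
Qed.

End Convolution.

Definition biproduct (V V1 V2 : nilmod) : Prop :=
  exists (p1 : 'M[k]_(nilmod_dim V, nilmod_dim V1))
         (p2 : 'M[k]_(nilmod_dim V, nilmod_dim V2))
         (i1 : 'M[k]_(nilmod_dim V1, nilmod_dim V))
         (i2 : 'M[k]_(nilmod_dim V2, nilmod_dim V)),
    [/\ [/\ i1 *m p1 = 1%:M, i2 *m p2 = 1%:M, i1 *m p2 = 0 & i2 *m p1 = 0],
        p1 *m i1 + p2 *m i2 = 1%:M,
        nilmod_mx V *m p1 = p1 *m nilmod_mx V1,
        nilmod_mx V *m p2 = p2 *m nilmod_mx V2 &
        nilmod_mx V1 *m i1 = i1 *m nilmod_mx V /\
        nilmod_mx V2 *m i2 = i2 *m nilmod_mx V].

Lemma biproductP V V1 V2 :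
  nilmod_iso V (nilmod_dsum V1 V2) <-> biproduct V V1 V2.
Proof.
split.
  rewrite /nilmod_iso /nilmod_mx /nilmod_dim /=; rewrite -!/(nilmod_dim _).
  rewrite -!/(nilmod_mx _).
  move=> [P [Q [PQ QP VP]]].
  have QV : block_mx (nilmod_mx V1) 0 0 (nilmod_mx V2) *m Q = Q *m nilmod_mx V.
    by rewrite -[LHS]mul1mx -QP -mulmxA (mulmxA P) -VP -!mulmxA PQ mulmx1.
  move: PQ QP VP QV; rewrite -[P]hsubmxK -[Q]vsubmxK.
  set p1 := lsubmx P; set p2 := rsubmx P; set i1 := usubmx Q; set i2 := dsubmx Q.
  rewrite mul_row_col mul_col_row mul_mx_row mul_row_block mul_block_col.
  rewrite mul_col_mx !mulmx0 !mul0mx !addr0 !add0r.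
  rewrite scalar_mx_block => PQ /eq_block_mx[h11 h12 h21 h22].
  move=> /eq_row_mx[hp1 hp2] /eq_col_mx[hi1 hi2].
  by exists p1, p2, i1, i2.
move=> [p1 [p2 [i1 [i2 [[h11 h22 h12 h21] h hp1 hp2 _]]]]].
exists (row_mx p1 p2), (col_mx i1 i2); split.
- by rewrite mul_row_col.
- by rewrite mul_col_row h11 h12 h21 h22 -scalar_mx_block.
- rewrite mul_mx_row hp1 hp2 [nilmod_mx (nilmod_dsum _ _)]/=.
  by rewrite mul_row_block !mulmx0 addr0 add0r.
Qed.

Section ConvolutionDirectSum.
Variable F : fgl k.

Lemma tensmxDl m n p q (A B : 'M[k]_(m, n)) (C : 'M[k]_(p, q)) :
  (A + B) *t C = A *t C + B *t C.
Proof. by apply/matrixP => i j; rewrite !mxE mulrDl. Qed.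

Lemma tensmxDr m n p q (A : 'M[k]_(m, n)) (B C : 'M[k]_(p, q)) :
  A *t (B + C) = A *t B + A *t C.
Proof. by apply/matrixP => i j; rewrite !mxE mulrDr. Qed.

Lemma nilmod_conv_dsuml V V1 V2 W : nilmod_iso V (nilmod_dsum V1 V2) ->
  nilmod_iso (nilmod_conv F V W)
    (nilmod_dsum (nilmod_conv F V1 W) (nilmod_conv F V2 W)).
Proof.
move=> /biproductP[p1 [p2 [i1 [i2 [[h11 h22 h12 h21] h hp1 hp2 [hi1 hi2]]]]]].
apply/biproductP; exists (p1 *t 1%:M), (p2 *t 1%:M), (i1 *t 1%:M), (i2 *t 1%:M).
have hW : nilmod_mx W *m 1%:M = 1%:M *m nilmod_mx W by rewrite mul1mx mulmx1.
split; [split | | | | split];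
  try by apply: conv_mx_intertwine => //; apply: nilmod_mxP.
- by rewrite tensmx_mul h11 mulmx1 tensmx11.
- by rewrite tensmx_mul h22 mulmx1 tensmx11.
- by rewrite tensmx_mul h12 tens0mx.
- by rewrite tensmx_mul h21 tens0mx.
- by rewrite !tensmx_mul -tensmxDl h mulmx1 tensmx11.
Qed.

Lemma nilmod_conv_dsumr V W W1 W2 : nilmod_iso W (nilmod_dsum W1 W2) ->
  nilmod_iso (nilmod_conv F V W)
    (nilmod_dsum (nilmod_conv F V W1) (nilmod_conv F V W2)).
Proof.
move=> /biproductP[p1 [p2 [i1 [i2 [[h11 h22 h12 h21] h hp1 hp2 [hi1 hi2]]]]]].
apply/biproductP; exists (1%:M *t p1), (1%:M *t p2), (1%:M *t i1), (1%:M *t i2).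
have hV : nilmod_mx V *m 1%:M = 1%:M *m nilmod_mx V by rewrite mul1mx mulmx1.
split; [split | | | | split];
  try by apply: conv_mx_intertwine => //; apply: nilmod_mxP.
- by rewrite tensmx_mul h11 mulmx1 tensmx11.
- by rewrite tensmx_mul h22 mulmx1 tensmx11.
- by rewrite tensmx_mul h12 tensmx0.
- by rewrite tensmx_mul h21 tensmx0.
- by rewrite !tensmx_mul -tensmxDr h mulmx1 tensmx11.
Qed.

End ConvolutionDirectSum.
End NilpotentEndomorphisms.

Section GrothendieckRing.
Variable k : fieldType.

(* The free abelian group on isomorphism classes is taken as the free abelian
   group on the pairs (V, phi) modulo [V] = [W] for V isomorphic to W. *)
Inductive K0_null : {freeg (nilmod k) / int} -> Prop :=
  | K0_null0 : K0_null 0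
  | K0_nullB x y : K0_null x -> K0_null y -> K0_null (x - y)
  | K0_null_iso V W : nilmod_iso V W -> K0_null (<< V >> - << W >>)
  | K0_null_dsum V V1 V2 : nilmod_iso V (nilmod_dsum V1 V2) ->
      K0_null (<< V >> - (<< V1 >> + << V2 >>)).

Definition K0_nullb : pred {freeg (nilmod k) / int} :=
  fun x => `[< K0_null x >].

Lemma K0_nullb_zmod_closed : zmod_closed K0_nullb.
Proof.
split; first exact/asboolP/K0_null0.
by move=> x y /asboolP hx /asboolP hy; apply/asboolP/K0_nullB.
Qed.

HB.instance Definition _ :=
  GRing.isZmodClosed.Build {freeg (nilmod k) / int} K0_nullb
    K0_nullb_zmod_closed.

Definition K0 := Quotient.quot (GRing.ZmodClosed.clone _ K0_nullb _).
HB.instance Definition _ := GRing.Zmodule.on K0.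
HB.instance Definition _ := Quotient.on K0.

Definition K0_pi (x : {freeg (nilmod k) / int}) : K0 := \pi_K0 x.

Lemma K0_pi_eq x y : K0_pi x = K0_pi y <-> K0_null (x - y).
Proof.
have e : (K0_pi x == K0_pi y) = K0_nullb (x - y).
  exact/esym/Quotient.idealrBE.
split; first by move/eqP; rewrite e => /asboolP.
by move=> h; apply/eqP; rewrite e; apply/asboolP.
Qed.

Lemma K0_pi_zmod_morphism : zmod_morphism K0_pi.
Proof. by move=> x y; rewrite /K0_pi [LHS](@Quotient.pi_add) Quotient.pi_opp. Qed.

HB.instance Definition _ :=
  GRing.isZmodMorphism.Build {freeg (nilmod k) / int} K0 K0_pi
    K0_pi_zmod_morphism.

Definition K0_class (V : nilmod k) : K0 := K0_pi << V >>.

(* The class of k[[t]]/(t^n). *)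
Definition K0_f (n : nat) : K0 := K0_class (jordan_block k n).

Section Product.
Variable F : fgl k.

Definition freeg_conv (x y : {freeg (nilmod k) / int}) :
    {freeg (nilmod k) / int} :=
  fglift (fun V => fglift (fun W => << nilmod_conv F V W >>) y) x.

(* Independent of the choice of representatives, by K0_mul_pi below *)
Definition K0_mul (x y : K0) : K0 := K0_pi (freeg_conv (repr x) (repr y)).

Lemma freeg_convBl x1 x2 y :
  freeg_conv (x1 - x2) y = freeg_conv x1 y - freeg_conv x2 y.
Proof. exact: lift_is_additive. Qed.

Lemma freeg_convBr x y1 y2 :
  freeg_conv x (y1 - y2) = freeg_conv x y1 - freeg_conv x y2.
Proof.
rewrite /freeg_conv -[x]Freeg_enum !fglift_Freeg /prelift -sumrB.
by apply: eq_bigr => V _; rewrite -scalerBr lift_is_additive.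
Qed.

Lemma freeg_convU V W : freeg_conv << V >> << W >> = << nilmod_conv F V W >>.
Proof. by rewrite /freeg_conv !liftU !scale1r. Qed.

Lemma freeg_convDl x1 x2 y :
  freeg_conv (x1 + x2) y = freeg_conv x1 y + freeg_conv x2 y.
Proof.
have c0 : freeg_conv 0 y = 0 by rewrite -(subrr 0) freeg_convBl !subrr.
have cN : freeg_conv (- x2) y = - freeg_conv x2 y.
  by rewrite -[- x2]sub0r freeg_convBl c0 sub0r.
by rewrite -{1}[x2]opprK freeg_convBl cN opprK.
Qed.

Lemma freeg_convDr x y1 y2 :
  freeg_conv x (y1 + y2) = freeg_conv x y1 + freeg_conv x y2.
Proof.
have c0 : freeg_conv x 0 = 0 by rewrite -(subrr 0) freeg_convBr !subrr.
have cN : freeg_conv x (- y2) = - freeg_conv x y2.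
  by rewrite -[- y2]sub0r freeg_convBr c0 sub0r.
by rewrite -{1}[y2]opprK freeg_convBr cN opprK.
Qed.

Lemma K0_null_opp x : K0_null x -> K0_null (- x).
Proof. by rewrite -sub0r; apply/K0_nullB/K0_null0. Qed.

Lemma K0_null_add x y : K0_null x -> K0_null y -> K0_null (x + y).
Proof. by move=> hx hy; rewrite -[y]opprK; apply/K0_nullB/K0_null_opp. Qed.

Lemma freeg_gen_ind (P : {freeg (nilmod k) / int} -> Prop) :
  P 0 -> (forall x y, P x -> P y -> P (x - y)) -> (forall V, P << V >>) ->
  forall x, P x.
Proof.
move=> P0 PB PU x.
have PN y : P y -> P (- y) by move=> Py; rewrite -sub0r; apply: PB.
have PD y z : P y -> P z -> P (y + z).
  by move=> Py Pz; rewrite -[z]opprK; apply/PB/PN.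
have PM y n : P y -> P (y *+ n).
  by move=> Py; elim: n => [|n IH]; rewrite ?mulr0n // mulrS; apply: PD.
rewrite -[x]freeg_sumE; apply: big_ind => // V _.
rewrite -[coeff V x]intz -freegU_mulz.
by case: (coeff V x) => n; [|apply: PN]; apply: PM.
Qed.

Lemma K0_null_convl x y : K0_null x -> K0_null (freeg_conv x y).
Proof.
move=> x0; elim/freeg_gen_ind: y => [|y1 y2 h1 h2|W].
- by rewrite -(subrr 0) freeg_convBr subrr; apply: K0_null0.
- by rewrite freeg_convBr; apply: K0_nullB.
elim: x0 => [|x1 x2 _ h1 _ h2|V V' VV'|V V1 V2 VV].
- by rewrite -(subrr 0) freeg_convBl subrr; apply: K0_null0.
- by rewrite freeg_convBl; apply: K0_nullB.
- rewrite freeg_convBl !freeg_convU; apply/K0_null_iso/nilmod_conv_iso => //.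
  by exists 1%:M, 1%:M; rewrite !mul1mx mulmx1.
- rewrite freeg_convBl freeg_convDl !freeg_convU.
  exact/K0_null_dsum/nilmod_conv_dsuml.
Qed.

Lemma K0_null_convr x y : K0_null y -> K0_null (freeg_conv x y).
Proof.
move=> y0; elim/freeg_gen_ind: x => [|x1 x2 h1 h2|V].
- by rewrite -(subrr 0) freeg_convBl subrr; apply: K0_null0.
- by rewrite freeg_convBl; apply: K0_nullB.
elim: y0 => [|y1 y2 _ h1 _ h2|W W' WW'|W W1 W2 WW].
- by rewrite -(subrr 0) freeg_convBr subrr; apply: K0_null0.
- by rewrite freeg_convBr; apply: K0_nullB.
- rewrite freeg_convBr !freeg_convU; apply/K0_null_iso/nilmod_conv_iso => //.
  by exists 1%:M, 1%:M; rewrite !mul1mx mulmx1.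
- rewrite freeg_convBr freeg_convDr !freeg_convU.
  exact/K0_null_dsum/nilmod_conv_dsumr.
Qed.

Lemma K0_mul_pi x y : K0_mul (K0_pi x) (K0_pi y) = K0_pi (freeg_conv x y).
Proof.
have null_repr z : K0_null (repr (K0_pi z) - z).
  by apply/K0_pi_eq; rewrite /K0_pi reprK.
apply/K0_pi_eq; set x' := repr _; set y' := repr _.
have -> : freeg_conv x' y' - freeg_conv x y =
    freeg_conv (x' - x) y' + freeg_conv x (y' - y).
  by rewrite freeg_convBl freeg_convBr addrA subrK.
by apply: K0_null_add;
  [apply: K0_null_convl | apply: K0_null_convr]; apply: null_repr.
Qed.

Lemma K0_mul_class V W :
  K0_mul (K0_class V) (K0_class W) = K0_class (nilmod_conv F V W).
Proof. by rewrite K0_mul_pi freeg_convU. Qed.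

Lemma K0_mulDl : left_distributive K0_mul +%R.
Proof.
move=> a b c; rewrite -[a]reprK -[b]reprK -[c]reprK -!/(K0_pi _).
by rewrite -[X in K0_mul X]raddfD !K0_mul_pi freeg_convDl [LHS]raddfD.
Qed.

Lemma K0_mulDr : right_distributive K0_mul +%R.
Proof.
move=> a b c; rewrite -[a]reprK -[b]reprK -[c]reprK -!/(K0_pi _).
by rewrite -[X in K0_mul _ X]raddfD !K0_mul_pi freeg_convDr [LHS]raddfD.
Qed.

End Product.

(* The index starts at 1: lam 0 is unconstrained. *)
Definition K0_expansion (x : K0) (lam : nat -> int) : Prop :=
  exists N, (forall i, (N < i)%N -> lam i = 0) /\
            x = \sum_(1 <= i < N.+1) K0_f i *~ lam i.

End GrothendieckRing.

(* Main.v *)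
(* Since F(x, 0) = x and F(0, y) = y, one can write F = x u(x, y) + y with
   u(0, 0) = 1.  As u is a unit, x |-> x u, y |-> y is an automorphism of
   k[x, y]/(x^m, y^n), and it carries x + y to F.  So f_m f_n is the class of
   multiplication by x + y, an endomorphism with integer matrix; the ranks of
   its powers depend only on the characteristic of k, and V |-> rank(phi^r),
   r >= 0, are additive invariants that determine the coefficients on the
   basis f_i. *)
Require Import Defs.
From mathcomp Require Import all_boot all_order all_algebra.
From HB Require Import structures.
From mathcomp Require Import freeg mxtens.
Import GRing.Theory.
Local Open Scope ring_scope.

(** * Ranks of integer matrices over fields of equal characteristic *)

Section RankOfIntegerMatrices.

(** A positive n that vanishes in k is divisible by a prime that is the characteristic of k, hence
    also of k'. *)
Lemma natr_eq0_pchar (k k' : fieldType) n :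
  {subset [pchar k] <= [pchar k']} -> n%:R = 0 :> k -> n%:R = 0 :> k'.
Proof.
move=> hchar; have [->//|n_gt0 n0] := posnP n.
have [p pk] := natf0_pchar n_gt0 (introT eqP n0).
apply/eqP; rewrite -(dvdn_pcharf (hchar _ pk)) (dvdn_pcharf pk).
exact/eqP.
Qed.

Lemma intr_eq0_pchar (k k' : fieldType) (z : int) :
  {subset [pchar k] <= [pchar k']} -> z%:~R = 0 :> k -> z%:~R = 0 :> k'.
Proof.
move=> hchar; case: (intP z) => // n.
  exact: natr_eq0_pchar.
rewrite !rmorphN /= => /eqP; rewrite oppr_eq0 => /eqP n0.
by apply/eqP; rewrite oppr_eq0; apply/eqP; apply: natr_eq0_pchar n0.
Qed.

Lemma mxrank_mxsub_le (k : fieldType) m n r s (f : 'I_r -> 'I_m)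
    (g : 'I_s -> 'I_n) (A : 'M[k]_(m, n)) : (\rank (mxsub f g A) <= \rank A)%N.
Proof.
apply: (@leq_trans (\rank (colsub g A))).
  suff -> : mxsub f g A = rowsub f (colsub g A) by rewrite mxrankS ?rowsub_sub.
  by apply/matrixP => i j; rewrite !mxE.
rewrite -mxrank_tr -(mxrank_tr A) mxrankS //.
by rewrite trmx_mxsub rowsub_sub.
Qed.

(** Select a maximal independent family of rows, then as many independent columns of the resulting
    matrix. *)
Lemma exists_unit_mxsub (k : fieldType) m n (A : 'M[k]_(m, n)) :
  exists f g, (mxsub f g A : 'M_(\rank A)) \in unitmx.
Proof.
pose B := rowsub (maxrankfun A) A.
have Bfull : row_full B^T.
  by rewrite /row_full mxrank_tr; exact: maxrowsub_free.
exists (maxrankfun A), (fullrankfun Bfull).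
rewrite -unitmx_tr; suff -> : (mxsub (maxrankfun A) (fullrankfun Bfull) A)^T =
  rowsub (fullrankfun Bfull) B^T by exact: fullrowsub_unit.
by apply/matrixP => i j; rewrite !mxE.
Qed.

(* The rank is the size of the largest nonzero minor, and a minor of an
   integer matrix vanishes in a field according to the characteristic only. *)
Lemma mxrank_intr_pchar_le (k k' : fieldType) m n (M : 'M[int]_(m, n)) :
  [pchar k] =i [pchar k'] ->
  (\rank (map_mx intr M : 'M[k]_(m, n)) <=
   \rank (map_mx intr M : 'M[k']_(m, n)))%N.
Proof.
move=> hchar; have [f [g]] := exists_unit_mxsub _ _ _ (map_mx intr M : 'M[k]_(m, n)).
move: (\rank _) f g => r f g; rewrite -map_mxsub unitmxE unitfE det_map_mx => nz.
rewrite -[r](@mxrank_unit k' r (mxsub f g (map_mx intr M))) ?mxrank_mxsub_le //.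
rewrite -map_mxsub unitmxE unitfE det_map_mx; apply: contra nz => /eqP z0.
by apply/eqP/(@intr_eq0_pchar k') => // p; rewrite hchar.
Qed.

Lemma mxrank_intr_pchar (k k' : fieldType) m n (M : 'M[int]_(m, n)) :
  [pchar k] =i [pchar k'] ->
  \rank (map_mx intr M : 'M[k]_(m, n)) = \rank (map_mx intr M : 'M[k']_(m, n)).
Proof.
by move=> hchar; apply/eqP; rewrite eqn_leq !mxrank_intr_pchar_le.
Qed.

End RankOfIntegerMatrices.

(** * Triangular matrices and the conjugation between x + y and x u + y *)

Section UnitriangularMatrices.
Context {k : fieldType}.

Definition upper_unitrig d (U : 'M[k]_d) :=
  forall x y : 'I_d, (y <= x)%N -> U x y = (x == y)%:R.

Lemma upper_unitrigM d (U V : 'M[k]_d) :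
  upper_unitrig d U -> upper_unitrig d V -> upper_unitrig d (U *m V).
Proof.
move=> hU hV x y le_yx; rewrite mxE (bigD1 x) //= hU // eqxx mul1r hV //.
rewrite big1 ?addr0 // => z neq_zx; have [le_zx|lt_xz] := leqP z x.
  by rewrite hU // eq_sym (negPf neq_zx) mul0r.
rewrite hV; last by apply: ltnW; apply: leq_ltn_trans lt_xz.
by rewrite -val_eqE gtn_eqF ?mulr0 // (leq_ltn_trans le_yx).
Qed.

Lemma upper_unitrigX d (U : 'M[k]_d) i :
  upper_unitrig d U -> upper_unitrig d (U ^+ i).
Proof.
move=> hU; elim: i => [|i IH]; last by rewrite exprS -mulmxE; apply: upper_unitrigM.
by move=> x y _; rewrite expr0 mxE.
Qed.

Lemma upper_unitrig_unit d (U : 'M[k]_d) : upper_unitrig d U -> U \in unitmx.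
Proof.
move=> hU; rewrite -unitmx_tr unitmxE det_trig.
  by rewrite big1 ?unitr1 // => x _; rewrite mxE hU ?eqxx.
by apply/is_trig_mxP => x y lt_xy; rewrite mxE hU ?(ltnW lt_xy) // -val_eqE gtn_eqF.
Qed.

Definition strictly_upper d (A : 'M[k]_d) :=
  forall x y : 'I_d, (y <= x)%N -> A x y = 0.

(** Each factor [A] pushes the lowest possibly nonzero diagonal one step further up. *)
Lemma strictly_upper_mulX d (M A : 'M[k]_d) s i : strictly_upper d A ->
  (forall x y : 'I_d, (y < x + s)%N -> M x y = 0) ->
  forall x y : 'I_d, (y < x + s + i)%N -> (M *m A ^+ i) x y = 0.
Proof.
move=> hA hM; elim: i => [|i IH] x y lt_y.
  by rewrite expr0 -idmxE mulmx1 hM // -[s]addn0 addnA.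
rewrite exprSr -mulmxE mulmxA mxE big1 // => z _.
have [lt_z|le_z] := ltnP z (x + s + i)%N; first by rewrite IH ?mul0r.
by rewrite hA ?mulr0 // -ltnS; apply: leq_trans lt_y _; rewrite addnS ltnS.
Qed.

Lemma strictly_upper_monomial d (A B : 'M[k]_d) i j (x y : 'I_d) :
  strictly_upper d A -> strictly_upper d B ->
  (y < x + i + j)%N -> (A ^+ i *m B ^+ j) x y = 0.
Proof.
move=> hA hB; apply: strictly_upper_mulX => // {}x {}y lt_y.
rewrite -[A ^+ i]mul1mx (strictly_upper_mulX _ _ _ 0) ?addn0 // => {lt_y}x' y'.
by rewrite addn0 mxE -val_eqE => lt_y; rewrite gtn_eqF.
Qed.

(* [A] raises the grading [g] by one, [B] preserves it; [P] sends a vector [v]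
   of degree [i] to [v U^i], which turns [A] into [A U] and keeps [B]. *)
Lemma graded_twist d (A B U : 'M[k]_d) (g : 'I_d -> nat) :
  (forall x z, A x z != 0 -> g z = (g x).+1) ->
  (forall x z, B x z != 0 -> g z = g x) ->
  comm_mx A U -> comm_mx B U -> upper_unitrig d U ->
  exists2 P, P \in unitmx & (A + B) *m P = P *m (A *m U + B).
Proof.
move=> gA gB AU BU hU; pose P := \matrix_(x, y) (U ^+ g x) x y.
have comX C i : comm_mx C U -> C *m U ^+ i = U ^+ i *m C.
  by move=> CU; rewrite !mulmxE; apply: commrX.
exists P.
  (* Row x of [P] is row x of a power of [U], so [P] is itself unitriangular. *)
  by apply: upper_unitrig_unit => x y le_yx; rewrite mxE upper_unitrigX.
rewrite mulmxDl mulmxDr; congr (_ + _); apply/matrixP => x y.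
  (* Wherever [A x z] is nonzero, z has degree [(g x).+1], so the rows of [P] that contribute all
     come from the same power of [U]. *)
  transitivity ((A *m U ^+ (g x).+1) x y).
    rewrite !mxE; apply: eq_bigr => z _; have [->|nz] := eqVneq (A x z) 0.
      by rewrite !mul0r.
    by rewrite mxE (gA _ _ nz).
  rewrite exprSr -mulmxE mulmxA comX // -mulmxA !mxE.
  by apply: eq_bigr => z _; rewrite [P x z]mxE.
transitivity ((B *m U ^+ g x) x y).
  rewrite !mxE; apply: eq_bigr => z _; have [->|nz] := eqVneq (B x z) 0.
    by rewrite !mul0r.
  by rewrite mxE (gB _ _ nz).
by rewrite comX // !mxE; apply: eq_bigr => z _; rewrite [P x z]mxE.
Qed.

Lemma mxrank_exp_intertwine d (A B P : 'M[k]_d) r :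
  P \in unitmx -> A *m P = P *m B -> \rank (A ^+ r) = \rank (B ^+ r).
Proof.
move=> uP AP; rewrite -(@mxrankMfree _ _ _ _ (A ^+ r) P) ?row_free_unit //.
by rewrite (exp_intertwine r AP) eqmxMfull ?row_full_unit.
Qed.

End UnitriangularMatrices.

(** * Convolution of Jordan blocks and reduction to x + y *)

Section Convolution.
Context {k : fieldType}.
Variable F : fgl k.

(* [F(x, y) = x u(x, y) + y] with [u(0, 0) = 1]. *)
Lemma eval_mx_fgl d (A B : 'M[k]_d) :
  strictly_upper d A -> strictly_upper d B -> nilpotent A -> nilpotent B ->
  comm_mx A B ->
  exists U, [/\ upper_unitrig d U, comm_mx A U, comm_mx B U &
                eval_mx F A B = A *m U + B].
Proof.
move=> hA hB nA nB AB.
(* Truncating F at [d.+2] rather than [d] changes nothing by nilpotency, but keeps the coefficients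
   of 1 and y in range even for d = 0 or 1. Dividing the terms with i > 0 by x leaves [d.+1] values
   of i. *)
pose U := \sum_(i < d.+1) \sum_(j < d.+2) fgl_coef F i.+1 j *: (A ^+ i *m B ^+ j).
have comU C : comm_mx C A -> comm_mx C B -> comm_mx C U.
  move=> CA CB; apply: comm_mx_sum => i _; apply: comm_mx_sum => j _.
  rewrite /comm_mx -scalemxAl -scalemxAr; congr (_ *: _); rewrite !mulmxE.
  by apply: commrM; apply: commrX; [exact: CA | exact: CB].
exists U; split.
(* The term i = j = 0 is the identity because the coefficient of x in F is 1; every other monomial
   vanishes on and below the diagonal. *)
- move=> x y le_yx; rewrite summxE big_ord_recl summxE big_ord_recl.
  rewrite /= fgl_x0 eqxx scale1r !expr0 -idmxE mul1mx !mxE.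
  rewrite !big1 ?addr0 // => [i _|i _].
    rewrite summxE big1 // => j _.
    rewrite mxE strictly_upper_monomial ?mulr0 //.
    by rewrite /bump /= add1n addnS addSn ltnS -addnA (leq_trans le_yx) ?leq_addr.
  have := strictly_upper_monomial _ A B 0 i.+1 x y hA hB.
  rewrite expr0 -idmxE mul1mx => Bi0; rewrite mxE Bi0 ?mulr0 //.
  by rewrite addn0 addnS ltnS (leq_trans le_yx) ?leq_addr.
- by apply: comU.
- by apply: comU => //; apply: comm_mx_sym.
rewrite (eval_mxE F nA nB (leq_trans (leqnSn d) (leqnSn d.+1))) /trunc_eval.
rewrite big_ord_recl addrC; congr (_ + _).
  rewrite mulmx_sumr; apply: eq_bigr => i _.
  rewrite mulmx_sumr; apply: eq_bigr => j _.
  by rewrite -scalemxAr mulmxA mulmxE -exprS.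
rewrite !big_ord_recl /= !fgl_0y /= scale0r add0r scale1r expr0 -idmxE mul1mx.
by rewrite expr1 big1 ?addr0 // => j _; rewrite fgl_0y scale0r.
Qed.

(** The basis vector x^i y^j has index i n + j. Multiplication by x shifts the index by n;
    multiplication by y shifts it by 1 inside a block of length n. *)
Lemma jordan_tensl m n (x z : 'I_(m * n)) :
  (jordan_mx k m *t 1%:M) x z != 0 -> z = (x + n)%N :> nat.
Proof.
case: (mxtens_indexP x) => i j; case: (mxtens_indexP z) => i' j'.
rewrite tensmxE !mxE -natrM mulnb; case: andP => [[/eqP i'E /eqP<-] _|].
  by rewrite /= i'E mulSn -addnA addnC.
by rewrite eqxx.
Qed.

Lemma jordan_tensr m n (x z : 'I_(m * n)) :
  (1%:M *t jordan_mx k n) x z != 0 -> z = x.+1 :> nat /\ (z %/ n = x %/ n)%N.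
Proof.
case: (mxtens_indexP x) => i j; case: (mxtens_indexP z) => i' j'.
rewrite tensmxE !mxE -natrM mulnb.
case: andP => [[/eqP<- /eqP j'E] _|]; last by rewrite eqxx.
have n_gt0 : (0 < n)%N by apply: leq_ltn_trans (ltn_ord j).
by split; rewrite /= ?j'E ?addnS // -addnS -j'E !divnMDl ?divn_small.
Qed.

Lemma mxrank_conv_jordan m n r :
  \rank (conv_mx F (jordan_mx k m) (jordan_mx k n) ^+ r) =
  \rank ((jordan_mx k m *t 1%:M + 1%:M *t jordan_mx k n) ^+ r).
Proof.
rewrite /conv_mx; set A := _ *t _; set B := _ *t _.
have hA : strictly_upper _ A.
  move=> x y le_yx; apply/eqP; apply: contraLR le_yx => /jordan_tensl ->.
  have n_gt0 : (0 < n)%N by case: n @A @B x y => // n' A B [x]; rewrite muln0.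
  by rewrite -ltnNge -addn1 leq_add2l.
have hB : strictly_upper _ B.
  move=> x y le_yx; apply/eqP; apply: contraLR le_yx => /jordan_tensr[-> _].
  by rewrite -ltnNge.
have [||| U [hU AU BU ->]] := eval_mx_fgl _ _ _ hA hB.
- exact/nilpotent_tensl/nilpotent_jordan.
- exact/nilpotent_tensr/nilpotent_jordan.
- by rewrite /comm_mx !tensmx_mul !mul1mx !mulmx1.
(* The quotient of the index by n is the exponent of the first variable. *)
have [|| P uP APB] := graded_twist _ A B U (fun x => x %/ n)%N _ _ AU BU hU.
- move=> x z /jordan_tensl ->.
  have n_gt0 : (0 < n)%N by case: n {A B hA hB U hU AU BU} x z => // [[x]]; rewrite muln0.
  by rewrite divnDr ?dvdnn // divnn n_gt0 addn1.
- by move=> x z /jordan_tensr[].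
by symmetry; apply: mxrank_exp_intertwine APB.
Qed.

End Convolution.

(** The first row of the s-th power is the s-th unit vector, counted from 0. Hence the r-th power
    kills the blocks of size at most r but not the one of size r + 1. *)
Lemma jordan_mx_exp_corner (k : fieldType) r :
  (jordan_mx k r.+1 ^+ r) ord0 ord_max = 1.
Proof.
suff main s (i : 'I_r.+1) : i = s :> nat -> (jordan_mx k r.+1 ^+ s) ord0 i = 1.
  exact: main.
elim: s i => [|s IH] i i_s.
  by rewrite expr0 mxE -val_eqE /= i_s eqxx.
have lt_sr : (s < r.+1)%N by apply: leq_ltn_trans (ltn_ord i); rewrite i_s.
rewrite exprSr -mulmxE mxE (bigD1 (Ordinal lt_sr)) //= IH // mul1r.
rewrite big1 ?addr0 => [|j]; first by rewrite mxE /= i_s eqxx.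
by rewrite -val_eqE => neq_j; rewrite mxE i_s eqSS eq_sym (negPf neq_j) mulr0.
Qed.

(** * Independence of the ranks from the field and the group law *)

Section CharacteristicOnly.
Variables k k' : fieldType.
Hypothesis hchar : [pchar k] =i [pchar k'].

Let jordanZ n : 'M[int]_n := \matrix_(i, j) (j == i.+1 :> nat)%:R.

Let map_jordanZ (K : fieldType) n : map_mx intr (jordanZ n) = jordan_mx K n.
Proof. by apply/matrixP => i j; rewrite !mxE rmorph_nat. Qed.

Lemma mxrank_jordan_pchar n r :
  \rank (jordan_mx k n ^+ r) = \rank (jordan_mx k' n ^+ r).
Proof.
rewrite -!map_jordanZ -!(rmorphXn (map_mx _)) /=; exact: mxrank_intr_pchar.
Qed.

(** After the reduction to x + y, both sides are ranks of the same integer matrix [S ^+ r], read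
    over [k] and over [k']. *)
Lemma mxrank_conv_jordan_pchar (F : fgl k) (F' : fgl k') m n r :
  \rank (conv_mx F (jordan_mx k m) (jordan_mx k n) ^+ r) =
  \rank (conv_mx F' (jordan_mx k' m) (jordan_mx k' n) ^+ r).
Proof.
pose S := jordanZ m *t 1%:M + 1%:M *t jordanZ n.
have mapS (K : fieldType) : map_mx intr S =
    jordan_mx K m *t 1%:M + 1%:M *t jordan_mx K n.
  by rewrite map_mxD !map_mxT !map_jordanZ !map_mx1.
rewrite !mxrank_conv_jordan -!mapS -!(rmorphXn (map_mx _)) /=.
exact: mxrank_intr_pchar.
Qed.

End CharacteristicOnly.

(** * Ranks of powers as additive functions on [K0] *)

Section RankOnK0.
Context {k : fieldType}.
Variable r : nat.

Definition nilmod_rank (V : nilmod k) : nat := \rank (nilmod_mx V ^+ r).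

Lemma nilmod_rank_iso V W : nilmod_iso V W -> nilmod_rank V = nilmod_rank W.
Proof.
rewrite /nilmod_rank => -[P [Q [PQ QP VP]]].
have Pfree : row_free P by apply/row_freeP; exists Q.
have Pfull : row_full P by apply/row_fullP; exists Q.
by rewrite -(mxrankMfree _ Pfree) (exp_intertwine r VP) eqmxMfull.
Qed.

Lemma nilmod_rank_dsum V W :
  nilmod_rank (nilmod_dsum V W) = (nilmod_rank V + nilmod_rank W)%N.
Proof.
rewrite /nilmod_rank -rank_diag_block_mx -block_diag_exp.
by [].
Qed.

(** [int^o] is the integers as a module over themselves, since [fglift] takes values in a module. *)
Definition freeg_rank : {freeg (nilmod k) / int} -> int :=
  fglift (fun V => (nilmod_rank V)%:Z : int^o).

Lemma freeg_rank_is_zmod_morphism : zmod_morphism freeg_rank.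
Proof. exact: (@lift_is_additive _ _ int^o). Qed.

HB.instance Definition _ :=
  GRing.isZmodMorphism.Build {freeg (nilmod k) / int} int freeg_rank
    freeg_rank_is_zmod_morphism.

Lemma freeg_rankU V : freeg_rank << V >> = nilmod_rank V.
Proof. by rewrite /freeg_rank liftU scale1r. Qed.

Lemma freeg_rank_null x : K0_null x -> freeg_rank x = 0.
Proof.
elim=> [|x1 x2 _ h1 _ h2|V W VW|V V1 V2 VV].
- exact: raddf0.
- by rewrite raddfB /= h1 h2 subrr.
- by rewrite raddfB /= !freeg_rankU (nilmod_rank_iso _ _ VW) subrr.
rewrite raddfB raddfD /= !freeg_rankU (nilmod_rank_iso _ _ VV) nilmod_rank_dsum.
by rewrite PoszD subrr.
Qed.

(** Independent of the representative, by [K0_rank_pi]. *)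
Definition K0_rank (x : K0 k) : int := freeg_rank (repr x).

Lemma K0_rank_pi x : K0_rank (K0_pi x) = freeg_rank x.
Proof.
apply/eqP; rewrite -subr_eq0 /K0_rank -raddfB /= freeg_rank_null //.
by apply/K0_pi_eq; rewrite /K0_pi reprK.
Qed.

Lemma K0_rank_is_zmod_morphism : zmod_morphism K0_rank.
Proof.
move=> x y; rewrite -[x]reprK -[y]reprK -!/(K0_pi _).
by rewrite -(raddfB (@K0_pi k)) !K0_rank_pi raddfB.
Qed.

HB.instance Definition _ :=
  GRing.isZmodMorphism.Build (K0 k) int K0_rank K0_rank_is_zmod_morphism.

Lemma K0_rank_class V : K0_rank (K0_class V) = nilmod_rank V.
Proof. by rewrite K0_rank_pi freeg_rankU. Qed.

Lemma K0_rank_expansion N (lam : nat -> int) :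
  K0_rank (\sum_(1 <= i < N) K0_f k i *~ lam i) =
  \sum_(1 <= i < N) (\rank (jordan_mx k i ^+ r))%:Z * lam i.
Proof.
rewrite raddf_sum; apply: eq_bigr => i _.
by rewrite raddfMz /= K0_rank_class mulrzz.
Qed.

End RankOnK0.

(** * Recovering the coefficients from the ranks *)

Lemma K0_sum_widen (k : fieldType) N M (lam : nat -> int) : (N <= M)%N ->
  (forall i, (N < i)%N -> lam i = 0) ->
  \sum_(1 <= i < N.+1) K0_f k i *~ lam i = \sum_(1 <= i < M.+1) K0_f k i *~ lam i.
Proof.
move=> le_NM lam0; rewrite [RHS](@big_cat_nat _ _ _ N.+1) //=.
rewrite [X in _ = _ + X]big_nat [X in _ = _ + X]big1 ?addr0 // => i /andP[lt_Ni _].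
by rewrite lam0 ?mulr0z.
Qed.

Theorem proposition2p2 (k k' : fieldType)
    (hchar : [pchar k] =i [pchar k'])
    (F : fgl k) (F' : fgl k')
    (m n : nat) (hm : (1 <= m)%N) (hn : (1 <= n)%N)
    (lam lam' : nat -> int)
    (hlam : K0_expansion (K0_mul F (K0_f k m) (K0_f k n)) lam)
    (hlam' : K0_expansion (K0_mul F' (K0_f k' m) (K0_f k' n)) lam') :
  forall i : nat, (1 <= i)%N -> lam i = lam' i.
Proof.
case: hlam hlam' => [N [lam0 eqN]] [N' [lam0' eqN']].
pose M := (N + N')%N.
rewrite (K0_sum_widen _ _ M) ?leq_addr // in eqN.
rewrite (K0_sum_widen _ _ M) ?leq_addl // in eqN'.
(* Applying the rank of the r-th power to both expansions gives, for each r, one linear relation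
   between the differences of coefficients. *)
have rank_eq r :
    \sum_(1 <= i < M.+1) (\rank (jordan_mx k i ^+ r))%:Z * (lam i - lam' i) = 0.
  under eq_bigr do rewrite mulrBr.
  rewrite sumrB -K0_rank_expansion -eqN.
  under [X in _ - X]eq_bigr do rewrite (mxrank_jordan_pchar _ _ hchar).
  rewrite -K0_rank_expansion -eqN' !K0_mul_class !K0_rank_class.
  by rewrite /nilmod_rank (mxrank_conv_jordan_pchar _ _ hchar F F') subrr.
(* Descending induction on i, with t bounding how far i lies below [M.+1]; for t = 0 both
   coefficients vanish. *)
suff main t i : (M < i + t)%N -> (1 <= i)%N -> lam i = lam' i.
  by move=> i; apply: (main M.+1); rewrite addnS ltnS leq_addl.
elim: t i => [|t IH] i.
  rewrite addn0 => lt_Mi _.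
  by rewrite lam0 ?lam0' //; apply: leq_ltn_trans lt_Mi; rewrite ?leq_addl ?leq_addr.
case: i => // i lt_M _; have [le_iM|lt_Mi] := ltnP i M; last first.
  by apply: IH => //; rewrite addSn ltnS (leq_trans lt_Mi) ?leq_addr.
(* The relation for r = i isolates the index i + 1: terms with larger j cancel by induction, blocks
   of size j <= i have zero i-th power, and the remaining rank is nonzero. *)
have := rank_eq i; rewrite (bigD1_seq i.+1) ?iota_uniq ?mem_index_iota //=.
rewrite big_nat_cond big1 ?addr0 => [/eqP|j /andP[/andP[j_gt0 _] neq_ji]].
  rewrite mulf_eq0 subr_eq0 => /orP[|/eqP//].
  rewrite -[0]/(Posz 0) eqz_nat mxrank_eq0 => /eqP/matrixP/(_ ord0 ord_max).
  by move/eqP; rewrite jordan_mx_exp_corner mxE oner_eq0.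
have [lt_ij|] := ltnP i.+1 j.
  by rewrite IH ?subrr ?mulr0 // (leq_trans lt_M) // addnS -addSn leq_add2r.
rewrite leq_eqVlt (negPf neq_ji) ltnS /= => le_ji.
suff -> : jordan_mx k j ^+ i = 0 by rewrite mxrank0 mul0r.
apply/matrixP => x y; rewrite jordan_mx_expE ?mxE //.
by rewrite (leq_trans (ltn_ord y)) // (leq_trans le_ji) ?leq_addl.
Qed.
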